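(* Let $n,p\geq 1$ be integers and let $A_1,\ldots, A_p\in \mathbb{C}^{n \times n}$ be positive definite matrices. Put $A_{p+1}:=A_1$. Then $$Tr\left(\sum_{i=1}^{p} A_i^2A_{i+1}^{-1}\right)\geq Tr(A_1 + \cdots +A_p).$$
   Context: A matrix $A\in\mathbb{C}^{n\times n}$ is called positive definite if it is Hermitian and $x^*Ax>0$ for all $0\neq x\in\mathbb{C}^n$. $Tr$ denotes the trace; the traces in the claim are real. *)

(* Defs.v *)
From mathcomp Require Import all_boot all_order all_algebra.
From mathcomp Require Import reals.
From mathcomp Require Import complex.

Set Implicit Arguments.
Unset Strict Implicit.
Unset Printing Implicit Defensive.

Import Order.TTheory GRing.Theory Num.Theory.
Local Open Scope ring_scope.
Local Open Scope sesquilinear_scope.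

(* The strict order of a [numClosedFieldType] is partial: [0 < z] says that z
   is real and positive. *)
Definition posdefmx (C : numClosedFieldType) (n : nat) (A : 'M[C]_n) : Prop :=
  A \is hermsymmx /\
  forall x : 'cV[C]_n, x != 0 -> 0 < (x ^t* *m A *m x) 0 0.

(* Main.v *)
Require Import Defs.
From mathcomp Require Import all_boot all_order all_algebra.
From mathcomp Require Import reals.
From mathcomp Require Import complex.

Set Implicit Arguments.
Unset Strict Implicit.
Unset Printing Implicit Defensive.

Import Order.TTheory GRing.Theory Num.Theory.
Local Open Scope ring_scope.

(** For Hermitian [A] and positive definite [B], the matrix
    [(A - B) B^-1 (A - B) = A B^-1 A - 2 A + B] is positive semidefinite, so
    [2 Tr A <= Tr (A^2 B^-1) + Tr B]. Summing around the cycle, the terms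
    [Tr A_(i+1)] cancel one of the two copies of [Tr A_i]. *)

Lemma hermsymmxP (C : numClosedFieldType) n (A : 'M[C]_n) :
  reflect (A ^t* = A)%sesqui (A \is hermsymmx).
Proof.
by rewrite is_hermitianmxE expr0 scale1r eq_sym; apply: eqP.
Qed.

Lemma adjointmxM (C : numClosedFieldType) m n p
    (A : 'M[C]_(m, n)) (B : 'M[C]_(n, p)) :
  ((A *m B) ^t* = B ^t* *m A ^t*)%sesqui.
Proof. by rewrite trmx_mul map_mxM. Qed.

(** If [B] were singular, a nonzero row [v] with [v *m B = 0] would make the form of [B] vanish at
    [v ^t*]. *)
Lemma posdefmx_unit (C : numClosedFieldType) n (B : 'M[C]_n) :
  posdefmx B -> B \in unitmx.
Proof.
case=> _ posB; rewrite unitmxE unitfE; apply/negP => /det0P[v v0 vB].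
have v'0 : (v ^t* != 0)%sesqui.
  by apply: contra_neq v0 => v'0; rewrite -(trmxCK v) v'0 trmx0 map_mx0.
by have := posB _ v'0; rewrite trmxCK vB mul0mx mxE ltxx.
Qed.

(** Each diagonal entry is the form of [B] at a column of [Y]. *)
Lemma mxtrace_congr_ge0 (C : numClosedFieldType) m n
    (B : 'M[C]_n) (Y : 'M[C]_(n, m)) :
  posdefmx B -> 0 <= \tr (Y ^t* *m B *m Y)%sesqui.
Proof.
case=> _ posB; apply: sumr_ge0 => i _.
have -> : (Y ^t* *m B *m Y)%sesqui i i
        = (((col i Y) ^t*)%sesqui *m B *m col i Y) 0 0.
  rewrite tr_col map_row -row_mul !mxE.
  by apply: eq_bigr => j _; rewrite !mxE.
have [->|/posB/ltW//] := eqVneq (col i Y) 0.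
by rewrite mulmx0 mxE.
Qed.

Lemma mxtrace_sqr_mul_inv_ge (C : numClosedFieldType) n (A B : 'M[C]_n) :
  A \is hermsymmx -> posdefmx B ->
  \tr A *+ 2 - \tr B <= \tr (A ^+ 2 *m invmx B).
Proof.
move=> /hermsymmxP hA pB; have uB := posdefmx_unit pB.
have /hermsymmxP hB := pB.1.
have := mxtrace_congr_ge0 (invmx B *m (A - B)) pB.
have -> : ((invmx B *m (A - B)) ^t* *m B = A - B)%sesqui.
  (* Writing the outer [B] as [B ^t*] lets it cancel [invmx B] under a single adjoint. *)
  rewrite -{3}hB -adjointmxM mulKVmx//.
  by rewrite linearB map_mxB /= hA hB.
rewrite mulmxBr mulVmx// mulmxBr mulmx1 mulmxBl !mulmxA mulmxV// mul1mx.
rewrite !linearB /= mxtrace_mulC mulmxA expr2 mulmxE.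
by rewrite -addrA -opprD subr_ge0 addrA -mulr2n.
Qed.

(* [ordS] is the cyclic successor on 'I_p, so that [A (ordS i)] is A_{i+1} with
   A_{p+1} = A_1. The order on R[i] is partial: the inequality also says that
   the imaginary parts of its two sides agree. *)
Theorem corollary2p14 (R : realType) (n p : nat) (hn : (0 < n)%N)
    (hp : (0 < p)%N) (A : 'I_p -> 'M[R[i]]_n)
    (hA : forall i : 'I_p, posdefmx (A i)) :
  \tr (\sum_(i < p) (A i) ^+ 2 *m invmx (A (ordS i))) >= \tr (\sum_(i < p) A i).
Proof.
rewrite !raddf_sum /=.
have -> : \sum_(i < p) \tr (A i)
        = \sum_(i < p) (\tr (A i) *+ 2 - \tr (A (ordS i))).
  (* Both sums of [\tr (A i)] are shifted by the bijection [ordS] to match the subtracted one. *)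
  by rewrite sumrB sumrMnl [LHS](reindex_inj (@ordS_inj p))
             [X in X *+ 2](reindex_inj (@ordS_inj p)) mulr2n addrK.
by apply: ler_sum => i _; apply: mxtrace_sqr_mul_inv_ge => //; have [] := hA i.
Qed.
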